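(* Let $N$ be an infinite finitely generated nilpotent group which is not cyclic. Then the profinite group $\mathcal{K}_N$ is not small.
   Context: For a profinite group $\mathcal{H}$, a continuous epimorphism $f:\mathcal{G}\to\mathcal{H}$ of profinite groups is a Frattini cover if for every closed subgroup $\mathcal{G}_0\leqslant\mathcal{G}$, $\mathcal{G}_0=\mathcal{G}$ iff $f(\mathcal{G}_0)=\mathcal{H}$; it is a universal Frattini cover if moreover $\mathcal{G}$ is projective. It is unique up to isomorphism over $\mathcal{H}$; its domain is denoted $\widetilde{\mathcal{H}}$. Set $\mathcal{K}_{\mathcal{H}}:=\ker(\widetilde{\mathcal{H}}\to\mathcal{H})$, and for an abstract group $N$ let $\mathcal{K}_N:=\mathcal{K}_{\widehat{N}}$, where $\widehat{N}$ is the profinite completion of $N$. A profinite group is small if for each $n>0$ it has only finitely many open normal subgroups of index $n$. *)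

(* Defs.v *)
From HB Require Import structures.
From mathcomp Require Import all_boot.
From mathcomp Require Import all_classical.
From mathcomp Require Import topology.

Set Implicit Arguments.
Unset Strict Implicit.
Unset Printing Implicit Defensive.

Local Open Scope classical_set_scope.
Local Open Scope card_scope.
Local Open Scope group_scope.

Section AbstractGroups.
Variable G : groupType.
Implicit Types (A H : set G) (x y : G).

Definition subgroup H :=
  [/\ H 1, forall x y, H x -> H y -> H (x * y) & forall x, H x -> H x^-1].

Definition normal_subgroup H :=
  subgroup H /\ forall x y, H x -> H (x ^ y).

Definition generated A : set G := smallest subgroup A.

Definition finitely_generated :=
  exists2 A, finite_set A & generated A = [set: G].

Definition cyclic_group := exists x, generated [set x] = [set: G].

Fixpoint lower_central_series n : set G :=
  if n is m.+1 then
    generated [set [~ x, y] | x in lower_central_series m & y in [set: G]]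
  else [set: G].

Definition nilpotent_group := exists n, lower_central_series n = [set 1].

Definition left_coset H x : set G := [set x * h | h in H].

Definition left_cosets H : set (set G) := range (left_coset H).

Definition has_index H n := left_cosets H #= `I_n.

End AbstractGroups.

Arguments finitely_generated : clear implicits.
Arguments cyclic_group : clear implicits.
Arguments nilpotent_group : clear implicits.

HB.mixin Record isTopologicalGroup G & Group G & Topological G := {
  mulg_continuous : continuous (fun z : G * G => z.1 * z.2);
  invg_continuous : continuous (fun x : G => x^-1)
}.

#[short(type="topologicalGroupType")]
HB.structure Definition TopologicalGroup :=
  {G of Group G & Topological G & isTopologicalGroup G}.

HB.mixin Record isProfinite G & Topological G := {
  profinite_compact : compact [set: G];
  profinite_hausdorff : hausdorff_space G;
  profinite_totally_disconnected : totally_disconnected [set: G]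
}.

#[short(type="profiniteGroupType")]
HB.structure Definition ProfiniteGroup :=
  {G of TopologicalGroup G & isProfinite G}.

#[short(type="continuousMorphism")]
HB.structure Definition ContinuousMorphism (G H : topologicalGroupType) :=
  {f of isUMagmaMorphism G H f & @isContinuous G H f}.


Section SubsetTopology.
Variables (T : topologicalType) (A : set T).

Lemma set_val_continuous : continuous (set_val : A -> T).
Proof. exact: initial_continuous. Qed.

Lemma continuous_to_subset (X : topologicalType) (g : X -> A) :
  continuous (set_val \o g : X -> T) -> continuous g.
Proof.
move=> gc x U [_ [[B oB <-] Bgx sBU]].
apply: (@filterS _ (nbhs x) _ ((set_val \o g) @^-1` B)).
  by move=> y By; apply: sBU.
by apply: gc; apply: open_nbhs_nbhs.
Qed.

Lemma compact_subset : compact A -> compact [set: A].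
Proof.
move=> cA F PF _.
have FA : F (set_val @^-1` A).
  by apply: filterS filterT => x _; exact: set_valP.
have [p [Ap clp]] := cA (set_val @ F) (fmap_proper_filter _ PF) FA.
exists (exist _ p (mem_set Ap)); split=> // B C FB [_ [[D oD <-] Dp sDC]].
have FvB : F (set_val @^-1` (set_val @` B)).
  by apply: filterS FB => x Bx; exists x.
have nD : nbhs p D by apply: open_nbhs_nbhs.
have [_ [[b Bb <-] Db]] := clp _ _ FvB nD.
by exists b; split=> //; apply: sDC.
Qed.

Lemma hausdorff_subset : hausdorff_space T -> hausdorff_space A.
Proof.
move=> hT p q pq; apply: val_inj; apply: hT => B C nB nC.
have [z [Bz Cz]] := pq _ _ (set_val_continuous nB) (set_val_continuous nC).
by exists (val z).
Qed.

Lemma totally_disconnected_subset :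
  totally_disconnected [set: T] -> totally_disconnected [set: A].
Proof.
move=> tdT x _; apply/seteqP; split=> [y [C [Cx _ cC] Cy]|_ ->]; last first.
  exact: connected_component_refl.
suff: connected_component [set: T] (set_val x) (set_val y).
  by rewrite tdT // => /val_inj.
exists (set_val @` C); last by exists y.
split=> //.
apply: connected_continuous_connected => //.
exact/continuous_subspaceT/set_val_continuous.
Qed.

End SubsetTopology.

Section Kernel.
Variables (G H : profiniteGroupType) (f : continuousMorphism G H).

Definition ker_set : set G := [set x | f x = 1].

Lemma ker_set_group_closed : group_closed (fun x => x \in ker_set).
Proof.
split=> [|x y /set_mem fx /set_mem fy]; apply/mem_set; rewrite /ker_set /=.
  exact: gmulf1.
by rewrite gmulfM gmulfV /= (fx : f x = 1) (fy : f y = 1) invg1 mulg1.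
Qed.

Lemma ker_set_closed : closed ker_set.
Proof.
have c1 : closed [set (1 : H)].
  by apply: accessible_closed_set1; apply: hausdorff_accessible;
     exact: profinite_hausdorff.
have cf : {in ~` f @^-1` [set 1], continuous f} by move=> x _; exact: cts_fun.
exact: (preimage_closed cf c1).
Qed.

(* The kernel carries the group structure and the topology induced by G *)
Definition kernel : Type := set_type ker_set.

HB.instance Definition _ := Topological.on kernel.
HB.instance Definition _ := SubChoice.on kernel.
HB.instance Definition _ :=
  SubChoice_isSubGroup.Build G _ kernel ker_set_group_closed.

Lemma kernel_mulg_continuous :
  continuous (fun z : kernel * kernel => z.1 * z.2).
Proof.
apply: continuous_to_subset => z.
apply: (@continuous_comp _ (G * G)%type _
  (fun z : kernel * kernel => (val z.1, val z.2)) (fun z => z.1 * z.2)).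
  apply: cvg_pair; apply: continuous_comp.
  - exact: cvg_fst.
  - exact: set_val_continuous.
  - exact: cvg_snd.
  - exact: set_val_continuous.
exact: mulg_continuous.
Qed.

Lemma kernel_invg_continuous : continuous (fun x : kernel => x^-1).
Proof.
apply: continuous_to_subset => x.
apply: (@continuous_comp _ G _ (set_val : kernel -> G) (fun x => x^-1)).
  exact: set_val_continuous.
exact: invg_continuous.
Qed.

HB.instance Definition _ := isTopologicalGroup.Build kernel
  kernel_mulg_continuous kernel_invg_continuous.

Lemma kernel_compact : compact [set: kernel].
Proof.
apply: compact_subset.
exact: (subclosed_compact ker_set_closed (@profinite_compact G)).
Qed.

HB.instance Definition _ := isProfinite.Build kernel kernel_compact
  (hausdorff_subset (@profinite_hausdorff G))
  (totally_disconnected_subset (@profinite_totally_disconnected G)).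

End Kernel.

Section CosetArithmetic.
Variable G : groupType.
Implicit Types (A B C M : set G) (x y : G).

Definition set_mulg A B : set G := [set a * b | a in A & b in B].

Definition set_invg A : set G := [set a^-1 | a in A].

Lemma set_mulgA : associative set_mulg.
Proof.
move=> A B C; apply/seteqP; split=> [_ [a Aa [_ [b Bb [c Cc <-]] <-]]|].
  by exists (a * b); [exists a => //; exists b|exists c => //; rewrite mulgA].
move=> _ [_ [a Aa [b Bb <-]] [c Cc <-]].
by exists a => //; exists (b * c); [exists b => //; exists c|rewrite mulgA].
Qed.

Lemma set_mulgS A A' B B' :
  A `<=` A' -> B `<=` B' -> set_mulg A B `<=` set_mulg A' B'.
Proof.
move=> sA sB _ [a Aa [b Bb <-]]; exists a; first exact: sA.
by exists b => //; exact: sB.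
Qed.

Lemma left_coset1 M : left_coset M 1 = M.
Proof.
apply/seteqP; split=> [_ [h Mh <-]|h Mh]; first by rewrite mul1g.
by exists h => //; rewrite mul1g.
Qed.

Lemma left_cosetM M x y : normal_subgroup M ->
  set_mulg (left_coset M x) (left_coset M y) = left_coset M (x * y).
Proof.
move=> [[M1 MM MV] MJ]; apply/seteqP; split.
  move=> _ [_ [h Mh <-] [_ [k Mk <-] <-]].
  exists (h ^ y * k); first by apply: MM => //; exact: MJ.
  by rewrite conjgE !mulgA mulgK.
move=> _ [h Mh <-]; exists x; first by exists 1 => //; rewrite mulg1.
by exists (y * h); [exists h|rewrite mulgA].
Qed.

Lemma left_cosetV M x : normal_subgroup M ->
  set_invg (left_coset M x) = left_coset M x^-1.
Proof.
move=> [[M1 MM MV] MJ]; apply/seteqP; split=> [_ [_ [h Mh <-] <-]|].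
  exists (h^-1 ^ x^-1); first by apply: MJ; exact: MV.
  by rewrite conjgE invgK invgM !mulgA mulVg mul1g.
move=> _ [h Mh <-]; exists (x * h^-1 ^ x).
  by exists (h^-1 ^ x) => //; apply: MJ; exact: MV.
by rewrite -conjgC invgM invgK.
Qed.

End CosetArithmetic.

Section ProfiniteCompletion.
Variable N : groupType.

Definition finite_index_normal : set (set N) :=
  [set M | normal_subgroup M /\ finite_set (left_cosets M)].

(* The inverse limit of the finite discrete groups N / M inside their product. *)
(* An element of N / M is a left coset of M, i.e. an element of set N; the     *)
(* inclusion c M `<=` c M' says that N / M -> N / M' maps c M to c M'.         *)
Definition inverse_limit :
    set {ptws finite_index_normal -> discrete_topology (set N)} :=
  [set c | (forall M : finite_index_normal, left_cosets (val M) (c M)) /\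
           (forall M M' : finite_index_normal,
              val M `<=` val M' -> c M `<=` c M')].

Definition profinite_completion : Type := set_type inverse_limit.

HB.instance Definition _ := Topological.on profinite_completion.

Implicit Types (c d : profinite_completion) (M : finite_index_normal).

Lemma fin_normal M : normal_subgroup (val M).
Proof. by case: (set_valP M). Qed.

Lemma pc_coset c M : exists x, val c M = left_coset (val M) x.
Proof. by have [/(_ M) [x _ <-] _] := set_valP c; exists x. Qed.

Lemma pc_compat c M M' : val M `<=` val M' -> val c M `<=` val c M'.
Proof. by have [_ h] := set_valP c; exact: h. Qed.

Lemma pc_ext c d : (forall M, val c M = val d M) -> c = d.
Proof. by move=> cd; apply/val_inj/funext. Qed.

Lemma pc_one_subproof : inverse_limit (fun M => val M).
Proof. by split=> [M|//]; exists 1 => //; rewrite left_coset1. Qed.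

Lemma pc_mul_subproof c d :
  inverse_limit (fun M => set_mulg (val c M) (val d M)).
Proof.
split=> [M|M M' sM]; last by apply: set_mulgS; exact: pc_compat.
have [x ->] := pc_coset c M; have [y ->] := pc_coset d M.
by rewrite left_cosetM; [exists (x * y)|exact: fin_normal].
Qed.

Lemma pc_inv_subproof c : inverse_limit (fun M => set_invg (val c M)).
Proof.
split=> [M|M M' sM]; last by apply: image_subset; exact: pc_compat.
have [x ->] := pc_coset c M.
by rewrite left_cosetV; [exists x^-1|exact: fin_normal].
Qed.

Definition pc_one : profinite_completion :=
  exist (fun g => g \in inverse_limit) _ (mem_set pc_one_subproof).
Definition pc_mul c d : profinite_completion :=
  exist (fun g => g \in inverse_limit) _ (mem_set (pc_mul_subproof c d)).
Definition pc_inv c : profinite_completion :=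
  exist (fun g => g \in inverse_limit) _ (mem_set (pc_inv_subproof c)).

Lemma pc_mulA : associative pc_mul.
Proof. by move=> c d e; apply: pc_ext => M; exact: set_mulgA. Qed.

Lemma pc_mul1 : left_id pc_one pc_mul.
Proof.
move=> c; apply: pc_ext => M /=; have [x ->] := pc_coset c M.
rewrite -[X in set_mulg X _]left_coset1 left_cosetM ?mul1g //.
exact: fin_normal.
Qed.

Lemma pc_mulg1 : right_id pc_one pc_mul.
Proof.
move=> c; apply: pc_ext => M /=; have [x ->] := pc_coset c M.
rewrite -[X in set_mulg _ X]left_coset1 left_cosetM ?mulg1 //.
exact: fin_normal.
Qed.

Lemma pc_mulV : left_inverse pc_one pc_inv pc_mul.
Proof.
move=> c; apply: pc_ext => M /=; have [x ->] := pc_coset c M.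
have nM := fin_normal M.
by rewrite left_cosetV // left_cosetM // mulVg left_coset1.
Qed.

Lemma pc_mulgV : right_inverse pc_one pc_inv pc_mul.
Proof.
move=> c; apply: pc_ext => M /=; have [x ->] := pc_coset c M.
have nM := fin_normal M.
by rewrite left_cosetV // left_cosetM // mulgV left_coset1.
Qed.

HB.instance Definition _ :=
  isGroup.Build profinite_completion pc_mulA pc_mul1 pc_mulg1 pc_mulV pc_mulgV.

Local Notation prodT :=
  {ptws finite_index_normal -> discrete_topology (set N)}.

Lemma pc_coord_continuous M : continuous (fun c : prodT => c M).
Proof. exact: (@proj_continuous _ (fun=> discrete_topology (set N)) M). Qed.

Lemma pc_coord_nbhs c M : nbhs c [set d | val d M = val c M].
Proof.
have : nbhs (val c) [set d : prodT | d M = val c M].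
  apply: (@pc_coord_continuous M (val c) [set val c M]).
  exact: (@discrete_set1 (discrete_topology (set N))).
by move=> /set_val_continuous.
Qed.

(* Continuity into the completion amounts to local constancy of coordinates *)
Lemma continuous_to_pc (X : topologicalType) (g : X -> profinite_completion) :
  (forall x M, nbhs x [set y | val (g y) M = val (g x) M]) -> continuous g.
Proof.
move=> gM; apply: continuous_to_subset => x.
apply/cvg_sup => M A [_ [[B oB <-] Bx sBA]].
apply: filterS (gM x M) => y /= e; apply: sBA.
by have : B (sval (g y) M) by rewrite e.
Qed.

Lemma pc_mul_continuous :
  continuous (fun z : profinite_completion * profinite_completion =>
    z.1 * z.2).
Proof.
apply: continuous_to_pc => -[c d] M.
exists ([set c' | val c' M = val c M], [set d' | val d' M = val d M]) => /=.
  by split; exact: pc_coord_nbhs.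
by move=> [c' d'] [/= -> ->].
Qed.

Lemma pc_inv_continuous : continuous (fun x : profinite_completion => x^-1).
Proof.
apply: continuous_to_pc => c M.
by apply: filterS (pc_coord_nbhs c M) => d /= ->.
Qed.

HB.instance Definition _ := isTopologicalGroup.Build profinite_completion
  pc_mul_continuous pc_inv_continuous.

Lemma inverse_limit_closed : closed inverse_limit.
Proof.
move=> c clc.
have near2 M M' : exists2 d : prodT, inverse_limit d & d M = c M /\ d M' = c M'.
  have nM L : nbhs c [set d : prodT | d L = c L].
    apply: (@pc_coord_continuous L c [set c L]).
    exact: (@discrete_set1 (discrete_topology (set N))).
  have [d [ld [e e']]] := clc _ (filterI (nM M) (nM M')).
  by exists d.
split=> [M|M M' sM].
  by have [d [ld _] [<- _]] := near2 M M; exact: ld.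
by have [d [_ ld] [<- <-]] := near2 M M'; exact: ld.
Qed.

Lemma pc_compact : compact [set: profinite_completion].
Proof.
apply: compact_subset.
have cK : compact [set c : prodT | forall M, left_cosets (val M) (c M)].
  apply: (@tychonoff _ (fun=> discrete_topology (set N))
    (fun M => left_cosets (val M))) => M.
  by apply: finite_compact; case: (set_valP M).
by apply: (subclosed_compact inverse_limit_closed cK) => c [].
Qed.

Lemma pc_hausdorff : hausdorff_space profinite_completion.
Proof.
apply: hausdorff_subset.
apply: (@hausdorff_product _ (fun=> discrete_topology (set N))) => _.
exact: discrete_hausdorff.
Qed.

Lemma pc_totally_disconnected : totally_disconnected [set: profinite_completion].
Proof.
apply: totally_disconnected_subset; apply: zero_dimension_totally_disconnected.
apply: (@zero_dimension_prod _ (fun=> discrete_topology (set N))) => _.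
exact: discrete_zero_dimension.
Qed.

HB.instance Definition _ := isProfinite.Build profinite_completion
  pc_compact pc_hausdorff pc_totally_disconnected.

End ProfiniteCompletion.

Definition epimorphism (G H : profiniteGroupType)
    (f : continuousMorphism G H) :=
  f @` [set: G] = [set: H].

(* Projective object of the category of profinite groups *)
Definition projective (G : profiniteGroupType) :=
  forall (A B : profiniteGroupType) (alpha : continuousMorphism B A)
    (phi : continuousMorphism G A),
  epimorphism alpha ->
  exists gamma : continuousMorphism G B, forall x, alpha (gamma x) = phi x.

Definition frattini_cover (G H : profiniteGroupType)
    (f : continuousMorphism G H) :=
  epimorphism f /\
  forall G0 : set G, subgroup G0 -> closed G0 ->
    (G0 = [set: G] <-> f @` G0 = [set: H]).

Definition universal_frattini_cover (G H : profiniteGroupType)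
    (f : continuousMorphism G H) :=
  frattini_cover f /\ projective G.

Definition small (G : profiniteGroupType) :=
  forall n, (0 < n)%N ->
  finite_set [set U : set G | [/\ open U, normal_subgroup U & has_index U n]].

(* Main.v *)
Require Import Defs.
From HB Require Import structures.
From mathcomp Require Import all_boot all_order all_algebra.
From mathcomp Require Import all_classical.
From mathcomp Require Import topology zify.

(** Since [N] is infinite, finitely generated and nilpotent, it maps onto [Z];
    since it is moreover not cyclic, it maps onto [Z x Z/p] for some prime [p],
    hence onto [Z/p x Z/q] for every power [q] of [p]. By projectivity the
    resulting map from the cover [G] lifts to the wreath product
    [F_p wr Z/q], which maps onto [Z/p x Z/q] by summing the coordinates.
    If [g1] and [g2] in [G] lie above the two generators, the lift sends the
    iterated commutator [[g1, g2, ..., g2]] with [j] entries [g2] to [D^j b],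
    where [D] is the difference operator and [b] has coordinate sum [1].
    When [j] is at least the nilpotency class of [N], this commutator lies in
    the kernel [K] of the cover. As [D^(q-1) b] is the constant function [1]
    and [D^q = 0], the functionals [v |-> (D^i v)(0)] have pairwise distinct
    kernels on [K] for [i] up to [q] minus the class. So [K] has arbitrarily
    many open normal subgroups of index [p]. *)

Set Implicit Arguments.
Unset Strict Implicit.
Unset Printing Implicit Defensive.

Import Order.TTheory GRing.Theory Num.Theory.
Local Open Scope classical_set_scope.
Local Open Scope group_scope.

(** * Finitely generated abelian groups *)

Section IntegerSpan.
Local Open Scope ring_scope.
Variable A : zmodType.
Implicit Types (a t x y : A) (s : seq A) (H : set A).

(** The recursion exposes the coefficient of the head, so that proofs can adjoin one generator at a
    time. *)
Fixpoint zspan s : set A :=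
  if s is a :: s' then [set x | exists k : int, zspan s' (x - a *~ k)]
  else [set 0].

Definition subzmod H := H 0 /\ forall x y, H x -> H y -> H (x - y).

Lemma subzmodN H x : subzmod H -> H x -> H (- x).
Proof. by move=> [H0 HB] Hx; rewrite -sub0r; exact: HB. Qed.

Lemma subzmodD H x y : subzmod H -> H x -> H y -> H (x + y).
Proof.
by move=> sH Hx Hy; rewrite -[y]opprK; apply: sH.2 => //; exact: subzmodN.
Qed.

Lemma subzmodMn H x n : subzmod H -> H x -> H (x *+ n).
Proof.
move=> sH Hx; elim: n => [|n IHn]; first by rewrite mulr0n; exact: sH.1.
by rewrite mulrS; exact: subzmodD.
Qed.

Lemma subzmodMz H x k : subzmod H -> H x -> H (x *~ k).
Proof.
by move=> sH Hx; case: k => n; rewrite ?NegzE ?mulrNz -pmulrn;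
  [|apply: subzmodN => //]; exact: subzmodMn.
Qed.

Lemma zspan_subzmod s : subzmod (zspan s).
Proof.
elim: s => [|a s IHs] /=; first by split=> // x y -> ->; rewrite subrr.
split=> [|x y [k xk] [l yl]].
  by exists 0; rewrite mulr0z subrr; exact: IHs.1.
exists (k - l); suff -> : x - y - a *~ (k - l) = x - a *~ k - (y - a *~ l).
  exact: IHs.2.
by rewrite mulrzBr !opprB addrACA [RHS]addrACA [- y - _]addrC.
Qed.

Lemma zspan_behead a s x : zspan s x -> zspan (a :: s) x.
Proof. by move=> sx; exists 0; rewrite mulr0z subr0. Qed.

Lemma zspan_head a s : zspan (a :: s) a.
Proof. by exists 1; rewrite subrr; exact: (zspan_subzmod s).1. Qed.

Lemma zspan_catr s1 s2 x : zspan s2 x -> zspan (s1 ++ s2) x.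
Proof. by move=> sx; elim: s1 => //= a s1 IHs; exact: zspan_behead. Qed.

Lemma zspan_catl s1 s2 x : zspan s1 x -> zspan (s1 ++ s2) x.
Proof.
elim: s1 x => [x ->|a s1 IHs x [k xk]] /=; first exact: (zspan_subzmod s2).1.
by exists k; exact: IHs.
Qed.

Lemma mem_zspan s a : a \in s -> zspan s a.
Proof.
elim: s => // b s IHs; rewrite inE => /orP[/eqP->|/IHs];
  first exact: zspan_head.
exact: zspan_behead.
Qed.

(** The admissible [k] form an ideal of the integers, and [d] is its generator; [d = 0] encodes
    infinite order of [a] modulo [H]. *)
Lemma order_modP H a : subzmod H ->
  exists d : nat, forall k : int, H (a *~ k) <-> (d %| k)%Z.
Proof.
move=> sH.
have Habs k : H (a *~ k) <-> H (a *+ `|k|%N).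
  case: k => n; first by rewrite pmulrn.
  rewrite NegzE mulrNz -pmulrn abszN absz_nat; split=> Hn; last exact: subzmodN.
  by rewrite -[_ *+ _]opprK; exact: subzmodN.
have [exH|noH] := pselect (exists n, `[<(0 < n)%N /\ H (a *+ n)>]); last first.
  exists 0%N => k; rewrite dvd0z; split=> [/Habs Hk|/eqP ->]; last first.
    by rewrite mulr0z; exact: sH.1.
  apply/negPn/negP => k0; apply: noH; exists `|k|%N; apply/asboolP.
  by split=> //; rewrite absz_gt0.
have [d /asboolP[d_gt0 Hd] dmin] := ex_minnP exH.
exists d => k; split=> [Hk|/dvdzP[q ->]]; last first.
  by rewrite mulrC mulrzA -pmulrn; exact: subzmodMz.
have Hr : H (a *~ (k %% d)%Z).
  rewrite /modz mulrzBr [_ * _]mulrC mulrzA -pmulrn.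
  by apply: sH.2 => //; exact: subzmodMz.
have r_ge0 : 0 <= (k %% d)%Z by rewrite modz_ge0 // -lt0n.
have r_ltd : (k %% d)%Z < d by rewrite ltz_pmod.
apply/dvdz_mod0P; apply/eqP/negPn/negP => r0.
have /dmin : `[<(0 < `|(k %% d)%Z|)%N /\ H (a *+ `|(k %% d)%Z|%N)>].
  by apply/asboolP; split; [rewrite absz_gt0|exact/Habs].
by rewrite -lez_nat gez0_abs // leNgt r_ltd.
Qed.

(** [phi x] is a chosen coefficient of [a] in [x]. Two choices differ by a multiple of [d], so [phi]
    is a homomorphism modulo [d], and an honest one when [d = 0]. *)
Lemma coef_hom s a d : (forall k : int, zspan s (a *~ k) <-> (d %| k)%Z) ->
  exists phi : A -> int,
   [/\ forall x y, zspan (a :: s) x -> zspan (a :: s) y ->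
         (d %| phi (x + y) - (phi x + phi y))%Z,
      forall x, zspan s x -> (d %| phi x)%Z & (d %| phi a - 1)%Z].
Proof.
move=> dP; pose phi x := xget 0 [set k : int | zspan s (x - a *~ k)].
have phiP x : zspan (a :: s) x -> zspan s (x - a *~ phi x).
  by move=> [k sk]; apply: (@xgetPex _ 0 [set k : int | zspan s (x - a *~ k)]);
     exists k.
have sS := zspan_subzmod s.
have sD := subzmodD sS.
exists phi; split=> [x y sx sy|x sx|].
- have sxy := subzmodD (zspan_subzmod _) sx sy; apply/dP.
  have := sS.2 _ _ (sD _ _ (phiP _ sx) (phiP _ sy)) (phiP _ sxy).
  rewrite [X in X - _]addrACA -opprD opprB [X in zspan _ X -> _]addrC subrKA.
  by rewrite -mulrzDr -mulrzBr.
- apply/dP; have := sS.2 _ _ sx (phiP x (zspan_behead a sx)).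
  by rewrite subKr.
apply/dP; have := subzmodN sS (phiP a (zspan_head a s)).
by rewrite opprB mulrzBr.
Qed.

(** Induction on the generators. If [a] has infinite order modulo the others, its coefficient is the
    homomorphism; otherwise multiplication by its order [d] sends everything into [zspan s], where
    the induction hypothesis applies. *)
Lemma exponent_or_hom s :
  (exists2 m, (0 < m)%N & forall x, zspan s x -> x *+ m = 0) \/
  (exists2 phi : A -> int,
    forall x y, zspan s x -> zspan s y -> phi (x + y) = phi x + phi y &
    exists2 x, zspan s x & phi x != 0).
Proof.
elim: s => [|a s IHs]; first by left; exists 1%N.
have [d dP] := order_modP a (zspan_subzmod s).
have [d0|d_gt0] := posnP d.
  have [phi [phiD phi0 phia]] := coef_hom dP; right; exists phi.
    move=> x y sx sy; apply/eqP; rewrite -subr_eq0 -dvd0z;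
      move: (phiD x y sx sy).
    by rewrite d0.
  exists a; first exact: zspan_head.
  by move: phia; rewrite d0 dvd0z subr_eq0 => /eqP ->.
have sd x : zspan (a :: s) x -> zspan s (x *+ d).
  move=> [k sk]; rewrite -[x](subrK (a *~ k)) mulrnDl.
  apply: (subzmodD (zspan_subzmod s));
    first exact: (subzmodMn _ (zspan_subzmod s)).
  by rewrite pmulrn -mulrzA; apply/dP; exact: dvdz_mull.
have [[m m_gt0 sm]|[phi phiD [x sx phix]]] := IHs; [left|right].
  exists (d * m)%N; first by rewrite muln_gt0 d_gt0.
  by move=> x /sd /sm; rewrite mulrnA.
exists (fun x => phi (x *+ d)).
  by move=> y z /sd sy /sd sz; rewrite mulrnDl phiD.
exists x; first exact: zspan_behead.
have phi0 : phi 0 = 0.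
  have s0 := (zspan_subzmod s).1.
  by have := phiD _ _ s0 s0; rewrite addr0 -{1}[phi 0]addr0 => /addrI <-.
have -> n : phi (x *+ n) = phi x *+ n.
  elim: n => [|n IHn]; first by rewrite !mulr0n.
  rewrite !mulrS phiD ?IHn //; exact: (subzmodMn _ (zspan_subzmod s)).
by rewrite mulrn_eq0 negb_or -lt0n d_gt0.
Qed.

(** Generators are dropped until the span becomes proper. The last one dropped, [a], has order
    [d != 1] modulo the rest, and its coefficient is reduced modulo a prime divisor of [d]. *)
Lemma exists_mod_prime_hom s0 s :
  zspan (s ++ s0) = [set: A] -> zspan s0 <> [set: A] ->
  exists2 p, prime p & exists psi : A -> 'F_p,
    [/\ forall x y, psi (x + y) = psi x + psi y,
        forall x, zspan s0 x -> psi x = 0 & exists x, psi x = 1].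
Proof.
elim: s => [//|a s IHs] sT s0T.
have [/IHs/(_ s0T)//|nsT] := pselect (zspan (s ++ s0) = [set: A]).
have [d dP] := order_modP a (zspan_subzmod (s ++ s0)).
have d1 : d != 1%N.
  apply/eqP => d1; apply: nsT; apply/seteqP; split=> // x _.
  have [k sk] : zspan (a :: s ++ s0) x by rewrite -cat_cons sT.
  rewrite -[x](subrK (a *~ k)); apply: (subzmodD (zspan_subzmod _)) => //.
  by apply/dP; rewrite d1 dvd1z.
have [phi [phiD phi0 phia]] := coef_hom dP.
have [p p_pr pd] : exists2 p, prime p & (p %| d)%N.
  (* Every prime divides [d = 0], so 2 is an arbitrary choice. *)
  have [->|d_gt0] := posnP d; first by exists 2%N.
  exists (pdiv d); last exact: pdiv_dvd.
  by apply: pdiv_prime; rewrite ltn_neqAle eq_sym d1.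
exists p => //; exists (fun x => (phi x)%:~R).
have Fp0 k : (d %| k)%Z -> k%:~R = 0 :> 'F_p.
  move=> dk; apply/eqP; rewrite -(dvdz_pcharf (pchar_Fp p_pr)).
  by apply: dvdz_trans dk.
split=> [x y|x sx|].
- apply/eqP; rewrite -subr_eq0 -intrD -intrB; apply/eqP/Fp0.
  by apply: phiD; rewrite -cat_cons sT.
- by apply: Fp0; apply: phi0; exact: zspan_catr.
- by exists a; apply/eqP; rewrite -subr_eq0 -[1]/(1%:~R) -intrB; apply/eqP/Fp0.
Qed.

End IntegerSpan.

(** * Lower central series and quotients *)

Section Generated.
Variable G : groupType.
Implicit Types (A H : set G) (x y : G).

Lemma generated_subgroup A : subgroup (generated A).
Proof.
split=> [H [[]]//|x y gx gy H HA|x gx H HA];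
  have [[_ HM HV] _] := HA; [apply: HM|apply: HV]; by [exact: gx|exact: gy].
Qed.

Lemma sub_generated A : A `<=` generated A.
Proof. by move=> x Ax H [_]; exact. Qed.

Lemma generated_min A H : subgroup H -> A `<=` H -> generated A `<=` H.
Proof. by move=> sH sA x; exact. Qed.

Lemma generated_normal A :
  (forall x y, A x -> A (x ^ y)) -> normal_subgroup (generated A).
Proof.
move=> AJ; have sgA := generated_subgroup A; split=> // x y gx.
apply: (@generated_min A [set z | generated A (z ^ y)] _ _ x gx); last first.
  by move=> z Az; apply: sub_generated; exact: AJ.
have [g1 gM gV] := sgA.
split=> [|z w gz gw|z gz] /=; rewrite ?conj1g ?conjMg ?conjVg //;
  [exact: gM|exact: gV].
Qed.

Lemma subgroupX H x n : subgroup H -> H x -> H (x ^+ n).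
Proof.
move=> [H1 HM _] Hx; elim: n => [|n IHn]; first by rewrite expg0.
by rewrite expgS; exact: HM.
Qed.

End Generated.

Section LowerCentralSeries.
Variable G : groupType.
Implicit Types (x y : G).
Local Notation lcs := (@lower_central_series G).

Lemma lcs_normal n : normal_subgroup (lcs n).
Proof.
elim: n => [|n [_ IHn]]; first by split.
apply: generated_normal => _ y [x1 lx1 [x2 _ <-]].
by exists (x1 ^ y); [exact: IHn|exists (x2 ^ y) => //; rewrite conjRg].
Qed.

Lemma lcs_comm n x y : lcs n x -> lcs n.+1 [~ x, y].
Proof. by move=> lx; apply: sub_generated; exists x => //; exists y. Qed.

Lemma lcsS n : lcs n.+1 `<=` lcs n.
Proof.
have [[l1 lM lV] lJ] := lcs_normal n.
apply: generated_min => // _ [x lx [y _ <-]].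
by rewrite commgEl; apply: lM; [exact: lV|exact: lJ].
Qed.

End LowerCentralSeries.

Section Quotient.
Variables (G : groupType) (L : set G) (nL : normal_subgroup L).

(* The proof [nL] is a phantom parameter, from which the group instance is
   recovered by unification. *)
Definition quotient : Type := let _ := nL in set_type (left_cosets L).
HB.instance Definition _ := Choice.on quotient.
Implicit Types q r : quotient.

Definition class (x : G) : quotient :=
  exist (fun c => c \in left_cosets L) _ (mem_set (imageT (left_coset L) x)).

Lemma class_surj q : exists x, q = class x.
Proof. by have [x _ e] := set_valP q; exists x; apply: val_inj. Qed.

Lemma classP x y : class x = class y <-> L (x^-1 * y).
Proof.
have [[L1 LM LV] _] := nL; split=> [[e]|Lxy].
  have [h Lh <-] : left_coset L x y by rewrite e; exists 1 => //; rewrite mulg1.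
  by rewrite mulKg.
apply: val_inj; apply/seteqP; split=> _ [h Lh <-].
  by exists ((x^-1 * y)^-1 * h); [apply: LM => //; exact: LV|
     rewrite invgM invgK !mulgA mulgV mul1g].
by exists (x^-1 * y * h); [exact: LM|rewrite !mulgA mulgV mul1g].
Qed.

Lemma quotient_mul_subproof q r : left_cosets L (set_mulg (val q) (val r)).
Proof.
have [x ->] := class_surj q; have [y ->] := class_surj r.
by exists (x * y) => //; rewrite left_cosetM.
Qed.

Lemma quotient_inv_subproof q : left_cosets L (set_invg (val q)).
Proof. by have [x ->] := class_surj q; exists x^-1 => //;
  rewrite left_cosetV. Qed.

Definition quotient_mul q r : quotient :=
  exist (fun c => c \in left_cosets L) _ (mem_set (quotient_mul_subproof q r)).
Definition quotient_inv q : quotient :=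
  exist (fun c => c \in left_cosets L) _ (mem_set (quotient_inv_subproof q)).

Lemma quotient_mul_class x y : quotient_mul (class x) (class y) = class (x * y).
Proof. by apply: val_inj; exact: left_cosetM. Qed.

Lemma quotient_inv_class x : quotient_inv (class x) = class x^-1.
Proof. by apply: val_inj; exact: left_cosetV. Qed.

Lemma quotient_mulA : associative quotient_mul.
Proof. by move=> q r s; apply: val_inj; exact: set_mulgA. Qed.

Lemma quotient_mul1 : left_id (class 1) quotient_mul.
Proof. by move=> q; have [x ->] := class_surj q;
  rewrite quotient_mul_class mul1g. Qed.

Lemma quotient_mulg1 : right_id (class 1) quotient_mul.
Proof. by move=> q; have [x ->] := class_surj q;
  rewrite quotient_mul_class mulg1. Qed.

Lemma quotient_mulV : left_inverse (class 1) quotient_inv quotient_mul.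
Proof.
move=> q; have [x ->] := class_surj q.
by rewrite quotient_inv_class quotient_mul_class mulVg.
Qed.

Lemma quotient_mulgV : right_inverse (class 1) quotient_inv quotient_mul.
Proof.
move=> q; have [x ->] := class_surj q.
by rewrite quotient_inv_class quotient_mul_class mulgV.
Qed.

HB.instance Definition _ := isGroup.Build quotient quotient_mulA quotient_mul1
  quotient_mulg1 quotient_mulV quotient_mulgV.

Lemma classM x y : class (x * y) = class x * class y.
Proof. by rewrite -quotient_mul_class. Qed.

Lemma classV x : class x^-1 = (class x)^-1.
Proof. by rewrite -quotient_inv_class. Qed.

Lemma class1 : class 1 = 1. Proof. by []. Qed.

Lemma classX x n : class (x ^+ n) = class x ^+ n.
Proof. by elim: n => [|n IHn]; rewrite ?expg0 // !expgS classM IHn. Qed.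

Lemma classR x y : class [~ x, y] = [~ class x, class y].
Proof. by rewrite !(commgEl, conjgE) !(classM, classV). Qed.

Lemma class_eq1 x : class x = 1 <-> L x.
Proof.
have [[_ _ LV] _] := nL; rewrite -class1 classP mulg1; split=> [/LV|/LV//].
by rewrite invgK.
Qed.

Lemma class_central x :
  (forall y, L [~ x, y]) -> forall q : quotient, commute (class x) q.
Proof.
move=> Lx q; have [y ->] := class_surj q.
by apply/commgP; rewrite -classR; apply/eqP/class_eq1.
Qed.

End Quotient.

(** * The abelianization, written additively *)

Section Abelianization.
Variable G : groupType.
Local Notation D := (lower_central_series 1 : set G).

Definition abelianization : Type := quotient (lcs_normal G 1).
HB.instance Definition _ := Choice.on abelianization.

Lemma abelianization_mulC : commutative (@quotient_mul _ _ (lcs_normal G 1)).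
Proof.
move=> q r; have [x ->] := class_surj q.
by apply: class_central => y; exact: lcs_comm.
Qed.

HB.instance Definition _ := GRing.isZmodule.Build abelianization
  (@quotient_mulA _ _ (lcs_normal G 1)) abelianization_mulC
  (@quotient_mul1 _ _ (lcs_normal G 1)) (@quotient_mulV _ _ (lcs_normal G 1)).

Definition ab (x : G) : abelianization := class (lcs_normal G 1) x.

Lemma abM x y : ab (x * y) = (ab x + ab y)%R.
Proof. exact: classM. Qed.

Lemma abV x : ab x^-1 = (- ab x)%R.
Proof. exact: classV. Qed.

Lemma ab1 : ab 1 = 0%R. Proof. by []. Qed.

Lemma abX x n : ab (x ^+ n) = (ab x *+ n)%R.
Proof.
by elim: n => [|n IHn];
  rewrite ?expg0 ?GRing.mulr0n // expgS GRing.mulrS abM IHn.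
Qed.

Lemma ab_eq0 x : ab x = 0%R <-> D x.
Proof. exact: class_eq1. Qed.

Lemma ab_surj q : exists x, q = ab x.
Proof. exact: class_surj. Qed.

Lemma ab_subgroup (H : set abelianization) : subzmod H -> subgroup (ab @^-1` H).
Proof.
move=> sH; split=> [|x y Hx Hy|x Hx] /=; first by rewrite ab1; exact: sH.1.
  by rewrite abM; exact: subzmodD.
by rewrite abV; exact: subzmodN.
Qed.

End Abelianization.

Section CentralElements.
Variable G : groupType.
Implicit Types (x y z : G).

Lemma commg_inv x y : [~ x, y]^-1 = [~ y, x].
Proof. by rewrite !commgEl !conjgE !invgM !invgK !mulgA. Qed.

Lemma commgMl_central x y z :
  (forall t, commute z t) -> [~ x * z, y] = [~ x, y].
Proof.
move=> cz; have -> : x * z = z * x by rewrite cz.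
by rewrite !commgEl conjMg invgM [z ^ y]conjgE (cz y) mulKg -mulgA mulKg.
Qed.

Lemma commgMr_central x y z :
  (forall t, commute z t) -> [~ x, y * z] = [~ x, y].
Proof. by move=> cz; rewrite -commg_inv commgMl_central // commg_inv. Qed.

End CentralElements.

(** * Finitely generated nilpotent groups *)

Section NilpotentGroups.
Variable N : groupType.
Implicit Types (A H L U T : set N) (x y t : N).
Local Notation lcs := (@lower_central_series N).

(** [H] is shown to cover [N] modulo each term of the lower central series by induction; the last
    term is trivial. *)
Lemma nilpotent_generated_mod_derived H : nilpotent_group N -> subgroup H ->
  (forall x, exists2 h, H h & lcs 1 (h^-1 * x)) -> H = [set: N].
Proof.
move=> [c lc1] [H1 HM HV] HD.
have HL i x : exists2 h, H h & lcs i (h^-1 * x).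
  elim: i x => [|i IHi] x; first by exists 1.
  pose cl := class (lcs_normal N i.+1).
  have sU : subgroup [set y | exists2 h, H h & cl h = cl y].
    split=> [|y z [h Hh e] [k Hk e']|y [h Hh e]]; first by exists 1.
      by exists (h * k); [exact: HM|rewrite /cl !classM [class _ h]e [class _
        k]e'].
    by exists h^-1; [exact: HV|rewrite /cl !classV [class _ h]e].
  (* Elements of [lcs i] are central modulo [lcs i.+1], so replacing the entries of a commutator by
     elements of [H] congruent modulo [lcs i] keeps its class. *)
  have DU : lcs 1 `<=` [set y | exists2 h, H h & cl h = cl y].
    apply: generated_min => // _ [y _ [z _ <-]] /=.
    have [h Hh hy] := IHi y; have [k Hk kz] := IHi z.
    exists [~ h, k].
      rewrite commgEl conjgE; apply: (HM); first exact: HV.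
      by apply: (HM); [exact: HV|exact: HM].
    have cen w : lcs i w -> forall q, commute (cl w) q.
      by move=> lw; apply: class_central => v; exact: lcs_comm.
    rewrite -[y](mulVKg h) -[z](mulVKg k) /cl !classR 2!(classM _ _ (_^-1 * _)).
    by rewrite commgMl_central ?commgMr_central //; exact: cen.
  have [h Hh /DU[k Hk e]] := HD x.
  exists (h * k); first exact: HM.
  by rewrite invgM -mulgA; apply/(classP (lcs_normal N i.+1)).
apply/seteqP; split=> // x _; have [h Hh] := HL c x.
by rewrite lc1 => /(canRL (mulVKg _)); rewrite mulg1 => ->.
Qed.

Definition finite_modulo U L :=
  exists2 T, finite_set T & forall x, U x -> exists2 t, T t & L (t^-1 * x).

Lemma finite_modulo_trans U V L :
  finite_modulo U V -> finite_modulo V L -> finite_modulo U L.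
Proof.
move=> [S fS US] [T fT VT]; exists [set s * t | s in S & t in T].
  exact: finite_image2.
move=> x /US[s Ss /VT[t Tt Lx]]; exists (s * t); first by exists s => //;
  exists t.
by rewrite invgM -mulgA.
Qed.

(** Modulo [L] the elements of [C] are central and killed by [m], so adjoining each of them
    multiplies the number of cosets by at most [m]. *)
Lemma finite_modulo_central L m (C : seq N) : normal_subgroup L -> (0 < m)%N ->
  (forall c, c \in C -> L (c ^+ m) /\ forall y, L [~ c, y]) ->
  exists U, [/\ subgroup U, L `<=` U, finite_modulo U L &
    forall c, c \in C -> U c].
Proof.
move=> nL m_gt0; have [[L1 LM LV] LJ] := nL.
elim: C => [|c C IHC] CP.
  exists L; split=> //; exists [set 1]; first exact: finite_set1.
  by move=> x Lx; exists 1 => //; rewrite invg1 mul1g.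
have [|U [sU LU [T fT UT] CU]] := IHC.
  by move=> b bC; apply: CP; rewrite inE bC orbT.
have [U1 UM UV] := sU.
pose cl := class nL.
have [Lcm cen] := CP c (mem_head c C).
have cm : cl c ^+ m = 1 by rewrite -classX; apply/class_eq1.
have cC q : commute (cl c) q by exact: class_central.
exists [set x | exists k : nat, exists2 u, U u & cl x = cl c ^+ k * cl u].
split.
- split=> [|x y [k [u Uu ex]] [l [v Uv ey]]|x [k [u Uu ex]]].
  + by exists 0%N; exists 1 => //; rewrite expg0 mul1g.
  + exists (k + l)%N; exists (u * v); first exact: UM.
    rewrite /cl !classM [class _ x]ex [class _ y]ey expgnDr -!mulgA;
      congr (_ * _).
    by rewrite !mulgA; congr (_ * _); apply: commuteX; exact: commute_sym.
  (* Exponents are natural numbers: [k * m.-1] stands for [- k], the two being congruent modulo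
     [m]. *)
  + exists (k * m.-1)%N; exists u^-1; first exact: UV.
    rewrite /cl !classV [class _ x]ex invgM.
    have -> : (cl c ^+ k)^-1 = cl c ^+ (k * m.-1).
      apply: (mulgI (cl c ^+ k)); rewrite mulgV -expgnDr -mulnS prednK //.
      by rewrite mulnC expgnA cm expg1n.
    by apply: commuteX; exact: commute_sym.
- move=> x /LU Ux; exists 0%N; exists x => //; by rewrite expg0 mul1g.
- exists [set c ^+ k * t | k in `I_m & t in T].
    by apply: finite_image2 => //; exact: finite_II.
  move=> x [k [u /UT[t Tt Lu] ex]]; exists (c ^+ (k %% m) * t).
    by exists (k %% m)%N; [rewrite /= ltn_mod|exists t].
  apply/(classP nL); rewrite [RHS]ex classM classX.
  rewrite [in RHS](divn_eq k m) expgnDr mulnC expgnA cm expg1n mul1g.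
  by congr (_ * _); apply/classP.
- move=> b; rewrite inE => /orP[/eqP->|/CU Ub].
    by exists 1%N; exists 1 => //; rewrite expg1 mulg1.
  by exists 0%N; exists b => //; rewrite expg0 mul1g.
Qed.

Section FixedEntry.
Variables (i : nat) (t : N).
Hypothesis lt : lcs i t.
Let cl := class (lcs_normal N i.+2).

Let comm_central y q : commute (cl [~ t, y]) q.
Proof. by apply: class_central => z; do 2!apply: lcs_comm. Qed.

(** The identity [[t, yz] = [t, z] [t, y]^z] gives this, as [[t, y]] lies in [lcs i.+1] and is
    central modulo [lcs i.+2]. *)
Lemma class_commM y z : cl [~ t, y * z] = cl [~ t, y] * cl [~ t, z].
Proof.
have -> : [~ t, y * z] = [~ t, z] * [~ t, y] ^ z.
  by rewrite !commgEl !conjgE !invgM !mulgA; rewrite !(mulgVK, mulgK).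
rewrite /cl (classM _ [~ t, z]) conjgE (classM _ z^-1) (classM _ [~ t, y])
  classV.
by rewrite (comm_central y (class _ z)) mulKg; exact: comm_central.
Qed.

Lemma class_commX y n : cl [~ t, y ^+ n] = cl [~ t, y] ^+ n.
Proof.
elim: n => [|n IHn]; first by rewrite !expg0 commg1.
by rewrite !expgS class_commM IHn.
Qed.

(** The homomorphism [y |-> cl [~ t, y]] has commuting values, hence kills commutators. *)
Lemma class_comm_derived d : lcs 1 d -> cl [~ t, d] = 1.
Proof.
move: d; apply: (@generated_min _ _ [set d | cl [~ t, d] = 1]).
  split=> [|x y /= ex ey|x /= ex]; first by rewrite /= commg1.
    by rewrite class_commM ex ey mulg1.
  by apply: (mulgI (cl [~ t, x])); rewrite -class_commM mulgV commg1 ex mulg1.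
move=> _ [y _ [z _ <-]] /=.
apply: (mulgI (cl [~ t, z * y])); rewrite -class_commM -commgC mulg1.
by rewrite !class_commM; exact: comm_central.
Qed.

End FixedEntry.

(** Each factor [lcs i / lcs i.+1] is finite: commutators of representatives generate the next
    factor, and bilinearity passes the exponent [m] on to them. *)
Lemma finite_of_finite_exponent_abelianization m : finitely_generated N ->
  nilpotent_group N -> (0 < m)%N -> (forall x, lcs 1 (x ^+ m)) ->
  finite_set [set: N].
Proof.
move=> [A /finite_seqP[C ->] genC] [c lc1] m_gt0 expm.
have fin0 : finite_modulo (lcs 0) (lcs 1).
  have [|U [sU LU fU CU]] :=
    @finite_modulo_central (lcs 1) m C (lcs_normal N 1) m_gt0.
    by move=> x _; split=> [//|y]; exact: lcs_comm.
  by rewrite -[lcs 0]/[set: N] -genC; case: fU => T fT UT; exists T => // x;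
     move=> /(generated_min sU CU); exact: UT.
have [S0 /finite_seqP[S ->] SP] := fin0.
have finS i : finite_modulo (lcs i) (lcs i.+1).
  elim: i => [//|i [T0 /finite_seqP[T ->] TP]].
  (* The filter discards representatives outside [lcs i], for which these commutators need not be
     central modulo [lcs i.+2]. *)
  pose E := [seq [~ t, s] | t <- [seq t <- T | `[<lcs i t>]], s <- S].
  have [|U [sU LU [V fV UV] EU]] :=
    @finite_modulo_central (lcs i.+2) m E (lcs_normal N i.+2) m_gt0.
    move=> _ /allpairsP[[t s] /= [+ sS ->]];
      rewrite mem_filter => /andP[/asboolP lt tT].
    split=> [|y]; last exact: (lcs_comm y (lcs_comm s lt)).
    by apply/(class_eq1 (lcs_normal N i.+2));
      rewrite classX -(class_commX lt) class_comm_derived.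
  exists V => // x lx; apply: UV; move: x lx.
  have [U1 UM UV] := sU.
  apply: generated_min => // _ [x lx [y _ <-]].
  have [t /= tT ltx] := TP x lx; have [s /= sS lsy] := SP y I.
  have [[_ lM lV] _] := lcs_normal N i.
  have lt : lcs i t.
    rewrite -[t]invgK; apply: (lV); rewrite -[t^-1](mulgK x); apply: lM;
      last exact: lV.
    exact: lcsS.
  rewrite -[[~ x, y]](mulVKg [~ t, s]); apply: UM.
    by apply: EU; apply/allpairsP; exists (t, s);
      rewrite /= mem_filter tT andbT; split=> //;
      apply/asboolP.
  apply: LU; apply/(classP (lcs_normal N i.+2)).
  rewrite -[x](mulVKg t) [RHS]classR classM commgMl_central; last first.
    by apply: class_central => w; exact: lcs_comm.
  by rewrite -classR -[y](mulVKg s) class_commM // [X in _ =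
    _ * X]class_comm_derived // mulg1.
have [T fT NT] : finite_modulo [set: N] (lcs c).
  elim: (c) => [|i IHi]; last exact: finite_modulo_trans IHi (finS i).
  exists [set 1]; first exact: finite_set1.
  by move=> x _; exists 1.
apply: sub_finite_set fT => x _; have [t Tt] := NT x I.
by rewrite lc1 => /(canRL (mulVKg _)); rewrite mulg1 => ->.
Qed.

Lemma exists_int_and_mod_prime_homs : infinite_set [set: N] ->
  finitely_generated N -> nilpotent_group N -> ~ cyclic_group N ->
  exists2 p, prime p & exists (phi : N -> int) (psi : N -> 'F_p),
    [/\ forall x y, phi (x * y) = (phi x + phi y)%R,
        forall x y, psi (x * y) = (psi x + psi y)%R,
        exists2 t, phi t = 1%R & psi t = 0%R &
        exists2 s, phi s = 0%R & psi s = 1%R].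
Proof.
move=> infN fgN nilN ncN.
have [_ /finite_seqP[C ->] genC] := fgN.
pose s := map (@ab N) C.
have sT : zspan s = [set: abelianization N].
  apply/seteqP; split=> // q _; have [x ->] := ab_surj q.
  have : generated [set` C] x by rewrite genC.
  apply: (generated_min (ab_subgroup (zspan_subzmod s))) => y /= yC.
  by apply: mem_zspan; exact: map_f.
have [[m m_gt0 sm]|[phi0 phi0D [q0 _ phi0_neq0]]] := exponent_or_hom s.
  have [] := infN; apply: finite_of_finite_exponent_abelianization m_gt0 _ =>
    // x.
  by apply/ab_eq0; rewrite abX sm // sT.
have {}phi0D (x y : abelianization N) : phi0 (x + y)%R = (phi0 x + phi0 y)%R.
  by apply: phi0D; rewrite sT.
have phi00 : phi0 0%R = 0%R.
  by apply: (@addrI _ (phi0 0%R)); rewrite -phi0D !addr0.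
have phi0N (x : abelianization N) : phi0 (- x)%R = (- phi0 x)%R.
  by apply: (@addrI _ (phi0 x)); rewrite -phi0D !subrr.
have s_range : subzmod (range phi0).
  split=> [|_ _ [x _ <-] [y _ <-]]; first by exists 0%R.
  by exists (x - y)%R => //; rewrite phi0D phi0N.
(* The range of [phi0] is generated by [d]; dividing by [d] makes the homomorphism onto. *)
have [d dP] := order_modP 1%R s_range.
have {}dP k : range phi0 k <-> (d %| k)%Z by rewrite -dP intz.
have d_neq0 : d != 0%N.
  apply/eqP => d0; have /dP : range phi0 (phi0 q0) by exists q0.
  by rewrite d0 dvd0z (negPf phi0_neq0).
have dphi (x : abelianization N) : (d %| phi0 x)%Z by apply/dP; exists x.
pose phi (x : abelianization N) := (phi0 x %/ d)%Z.
have phiD (x y : abelianization N) :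
  phi (x + y)%R = (phi x + phi y)%R by rewrite /phi phi0D divzDl.
have [t0 _ phit] : range phi0 d by apply/dP.
have {phit} phit : phi t0 = 1%R by rewrite /phi phit divzz; case: (d) d_neq0.
have [t e] := ab_surj t0; rewrite {}e {t0} in phit.
(* Otherwise [t] would generate [N] modulo its derived subgroup, hence [N] itself by nilpotency. *)
have t_proper : zspan [:: ab t] <> [set: abelianization N].
  move=> spt; apply: ncN; exists t.
  apply: nilpotent_generated_mod_derived => //; first exact: generated_subgroup.
  move=> x; have [k /= xk] : zspan [:: ab t] (ab x) by rewrite spt.
  have [gt1 gtM gtV] := generated_subgroup [set t].
  have gtX n : generated [set t] (t ^+ n).
    apply: (@subgroupX _ (generated [set t])); first exact: generated_subgroup.
    exact: sub_generated.
  case: k xk => n; rewrite ?NegzE ?mulrNz -pmulrn => xk.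
    by exists (t ^+ n) => //; apply/ab_eq0; rewrite abM abV abX addrC.
  exists (t ^- n.+1); first exact: gtV.
  by apply/ab_eq0; rewrite abM !abV abX addrC.
have [|p p_pr [psi [psiD psi0 [x0 psix]]]] :=
  @exists_mod_prime_hom _ [:: ab t] s _ t_proper.
  apply/seteqP; split=> // q _.
  have : zspan s q by rewrite sT.
  exact: zspan_catl.
exists p => //; exists (phi \o @ab N), (psi \o @ab N).
have psit : psi (ab t) = 0%R by apply: psi0; exact: zspan_head.
split=> [x y|x y||]; rewrite /= ?abM ?phiD ?psiD //; first by exists t.
have phi00' : phi 0%R = 0%R by rewrite /phi phi00 div0z.
have psi00 : psi 0%R = 0%R by apply: psi0; exact: (zspan_subzmod _).1.
have phiMn n : phi (ab t *+ n)%R = n.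
  elim: n => [|n IHn]; first by rewrite mulr0n.
  by rewrite mulrS phiD IHn phit -intS.
have psiMn n : psi (ab t *+ n)%R = 0%R.
  by elim: n => [|n IHn]; rewrite ?mulr0n // mulrS psiD IHn psit addr0.
have phiN (x : abelianization N) : phi (- x)%R = (- phi x)%R.
  by apply: (@addrI _ (phi x)); rewrite -phiD !subrr.
have psiN (x : abelianization N) : psi (- x)%R = (- psi x)%R.
  by apply: (@addrI _ (psi x)); rewrite -psiD !subrr.
(* Subtracting this multiple of [ab t] makes [phi] vanish and leaves [psi] unchanged, since [psi]
   kills [ab t]. *)
have [x e] := ab_surj (x0 - ab t *~ phi x0)%R.
exists x; rewrite -e.
  rewrite phiD phiN; case: (phi x0) => n; rewrite ?NegzE ?mulrNz -pmulrn.
    by rewrite phiMn subrr.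
  by rewrite phiN phiMn subrr.
rewrite psiD psiN psix; case: (phi x0) => n; rewrite ?NegzE ?mulrNz -pmulrn.
  by rewrite psiMn subr0.
by rewrite psiN psiMn oppr0 subr0.
Qed.

End NilpotentGroups.

(** * Wreath products and finite differences *)

Section Additive.
Variable A : zmodType.
Definition additive_group : Type := A.
HB.instance Definition _ := Choice.on additive_group.
HB.instance Definition _ := isGroup.Build additive_group
  (@addrA A) (@add0r A) (@addr0 A) (@addNr A) (@addrN A).
End Additive.

Section Wreath.
Variables (V : finZmodType) (C : finZmodType).

Definition wreath : Type := ({ffun C -> V} * C)%type.
HB.instance Definition _ := Finite.on wreath.
Implicit Types e : wreath.

Definition wreath_one : wreath := (0%R, 0%R).
(** The semidirect product law, with [C] acting on functions by translation of the argument. *)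
Definition wreath_mul e e' : wreath :=
  ([ffun k => e.1 k + e'.1 (k - e.2)%R]%R, (e.2 + e'.2)%R).
Definition wreath_inv e : wreath := ([ffun k => - e.1 (k + e.2)]%R, (- e.2)%R).

Lemma wreath_ext e e' : (forall k, e.1 k = e'.1 k) -> e.2 = e'.2 -> e = e'.
Proof. by case: e e' => [v i] [w j] /= /ffunP -> ->. Qed.

Lemma wreath_mulA : associative wreath_mul.
Proof.
move=> e e' e''; apply: wreath_ext => [k|] /=; last by rewrite addrA.
by rewrite !ffunE opprD !addrA.
Qed.

Lemma wreath_mul1 : left_id wreath_one wreath_mul.
Proof.
by move=> e; apply: wreath_ext => [k|] /=; rewrite ?ffunE /= ?subr0 ?add0r.
Qed.

Lemma wreath_mulg1 : right_id wreath_one wreath_mul.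
Proof. by move=> e; apply: wreath_ext => [k|] /=; rewrite ?ffunE /= ?addr0. Qed.

Lemma wreath_mulV : left_inverse wreath_one wreath_inv wreath_mul.
Proof.
by move=> e; apply: wreath_ext => [k|] /=; rewrite ?ffunE /= ?opprK ?addNr.
Qed.

Lemma wreath_mulgV : right_inverse wreath_one wreath_inv wreath_mul.
Proof.
by move=> e; apply: wreath_ext => [k|] /=; rewrite ?ffunE /= ?subrK ?subrr.
Qed.

HB.instance Definition _ := isGroup.Build wreath
  wreath_mulA wreath_mul1 wreath_mulg1 wreath_mulV wreath_mulgV.

Definition wreath_proj e : additive_group (V * C)%type := (\sum_k e.1 k, e.2)%R.

(** Translation permutes the coordinates and so preserves their sum. *)
Lemma wreath_projM e e' : wreath_proj (e * e') = wreath_proj e * wreath_proj e'.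
Proof.
congr (_, _) => /=; under eq_bigr do rewrite ffunE.
rewrite big_split /=; congr (_ + _)%R.
by rewrite [RHS](reindex_inj (addIr (- e.2)%R)).
Qed.

Lemma wreath_proj_surj a : exists e, wreath_proj e = a.
Proof.
case: a => a i; exists ([ffun k => if k == 0%R then a else 0%R], i);
  congr (_, _) => /=.
under eq_bigr do rewrite ffunE.
by rewrite -big_mkcond big_pred1_eq.
Qed.

End Wreath.

Section FiniteDifferences.
Variables (p r n : nat).
Hypotheses (p_pr : prime p) (qE : r.+2 = (p ^ n)%N).
Local Notation q := r.+2.
Local Open Scope ring_scope.
Implicit Types (v w b : {ffun 'Z_q -> 'F_p}) (k : 'Z_q).

(** This is [X - 1] acting on functions, with [X] the unit translation. Writing the modulus as
    [r.+2] makes ['Z_q] literally the ordinals below [q]. *)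
Definition fdiff v : {ffun 'Z_q -> 'F_p} := [ffun k => v (k + 1) - v k].

Lemma fdiff0 : fdiff 0 = 0.
Proof. by apply/ffunP => k; rewrite !ffunE subrr. Qed.

Lemma iter_fdiffD j v w :
  iter j fdiff (v + w) = iter j fdiff v + iter j fdiff w.
Proof.
elim: j => //= j ->; apply/ffunP => k; rewrite !ffunE opprD.
exact: addrACA.
Qed.

(** The binomial expansion of a power of [X - 1]. Any bound [m > j] is allowed, so that the
    induction can align the sums at [k + 1] and at [k]. *)
Lemma iter_fdiffE j v k m : (j < m)%N ->
  iter j fdiff v k = \sum_(i < m) (('X - 1 :
    {poly 'F_p}) ^+ j)`_i * v (k + i%:R).
Proof.
elim: j k m => [|j IHj] k [//|m] jm.
  rewrite expr0 big_ord_recl big1 => [|i _]; last by rewrite coef1 mul0r.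
  by rewrite coef1 mul1r !addr0.
rewrite /= ffunE (IHj _ m) // (IHj k m.+1) 1?ltnW // exprSr mulrBr mulr1.
under [RHS]eq_bigr do rewrite coefB mulrBl.
rewrite sumrB; congr (_ - _); rewrite big_ord_recl coefMX /= mul0r add0r.
apply: eq_bigr => i _; rewrite coefMX /= /bump /= add1n.
by rewrite mulrS addrA.
Qed.

(** In characteristic [p] the Frobenius gives [(X - 1)^q = X^q - 1]; a factor [X - 1] is then
    cancelled. *)
Lemma XsubC1_prime_power : ('X - 1 : {poly 'F_p}) ^+ q.-1 = \sum_(i < q) 'X^i.
Proof.
have X1 : 'X - 1 != 0 :> {poly 'F_p} by rewrite -polyC1 polyXsubC_eq0.
apply: (mulfI X1); rewrite -exprS -subrX1.
have pc : p \in [pchar {poly 'F_p}] by apply: (rmorph_pchar polyC);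
  exact: pchar_Fp.
have qn : [pchar {poly 'F_p}].-nat q.
  by rewrite (eq_pnat _ (pcharf_eq pc)) qE pnatX pnat_id.
by rewrite prednK // exprDn_pchar // exprNn_pchar // expr1n.
Qed.

Lemma iter_fdiff_top v k : iter q.-1 fdiff v k = \sum_k v k.
Proof.
rewrite (@iter_fdiffE _ _ _ q) // XsubC1_prime_power.
rewrite [RHS](reindex_inj (addrI k)) /=; apply: eq_bigr => i _.
rewrite coef_sum (bigD1 i) //= coefXn eqxx big1 => [|j ji].
  by rewrite addr0 mul1r natr_Zp.
by rewrite coefXn val_eqE eq_sym (negPf ji).
Qed.

(** The iterate of order [q.-1] is a constant function, so one more difference kills it. *)
Lemma iter_fdiff_big v j : (q <= j)%N -> iter j fdiff v = 0.
Proof.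
move=> /subnK <-; rewrite iterD; have -> : iter q fdiff v = 0.
  by apply/ffunP => k; rewrite [LHS]ffunE !iter_fdiff_top subrr ffunE.
by elim: (_ - _)%N => //= m ->; rewrite fdiff0.
Qed.

(** The base group is abelian, so [b] cancels and only the translation by 1 acts. *)
Lemma wreath_commg v b :
  [~ (v, 0%R) : wreath 'F_p 'Z_q, (b, 1%R) : wreath 'F_p 'Z_q]%g = (fdiff v, 0).
Proof.
rewrite /commg /conjg.
apply: wreath_ext => [k|] /=; last by rewrite oppr0 !add0r addNr.
by rewrite !ffunE /= oppr0 !subr0 !opprK !addr0 [v _ + b _]addrC addKr addrC.
Qed.

End FiniteDifferences.

(** * Finite discrete groups as profinite groups *)

Section DiscreteGroup.
Variables (E : groupType) (finE : finite_set [set: E]).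

(** The phantom [finE] keeps finiteness in the type, where the compactness instance finds it. *)
Definition discrete_group : Type := let _ := finE in discrete_topology E.
HB.instance Definition _ := Topological.on discrete_group.
HB.instance Definition _ := Group.copy discrete_group E.

Lemma discrete_group_nbhs1 (x : discrete_group) : nbhs x [set x].
Proof. exact: (@discrete_set1 (discrete_topology E)). Qed.

Lemma continuous_to_discrete (X : topologicalType) (g : X -> discrete_group) :
  (forall x, nbhs x [set y | g y = g x]) -> continuous g.
Proof.
move=> gl x A /nbhs_singleton Ax; apply: filterS (gl x) => y /= e.
by rewrite /= e.
Qed.

Lemma discrete_group_mulg_continuous :
  continuous (fun z : discrete_group * discrete_group => z.1 * z.2).
Proof.
apply: continuous_to_discrete => -[x y].
exists ([set x], [set y]); first by split; exact: discrete_group_nbhs1.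
by move=> [x' y'] [/= -> ->].
Qed.

Lemma discrete_group_invg_continuous :
  continuous (fun x : discrete_group => x^-1).
Proof.
apply: (@continuous_to_discrete discrete_group) => x.
by apply: (@filterS _ (nbhs x) (nbhs_filter x) _ _ _ (@discrete_group_nbhs1 x))
  => y ->.
Qed.

HB.instance Definition _ := isTopologicalGroup.Build discrete_group
  discrete_group_mulg_continuous discrete_group_invg_continuous.

Lemma discrete_group_compact : compact [set: discrete_group].
Proof. exact: finite_compact. Qed.

Lemma discrete_group_totally_disconnected :
  totally_disconnected [set: discrete_group].
Proof.
apply: zero_dimension_totally_disconnected.
exact: (@discrete_zero_dimension (discrete_topology E)).
Qed.

HB.instance Definition _ := isProfinite.Build discrete_group
  discrete_group_compact (@discrete_hausdorff (discrete_topology E))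
  discrete_group_totally_disconnected.

End DiscreteGroup.

(** * Building morphisms and computing with their values *)

Lemma continuous_morphism_of_fun (G H : topologicalGroupType) (g : G -> H) :
  (forall x y, g (x * y) = g x * g y) -> continuous g ->
  exists h : continuousMorphism G H, forall x, h x = g x.
Proof.
move=> gM gc.
have g1 : g 1 = 1 by apply: (mulgI (g 1)); rewrite -gM !mulg1.
pose mg := isUMagmaMorphism.Build G H g (conj g1 gM).
pose cg := isContinuous.Build G H g gc.
pose h : continuousMorphism G H := HB.pack g mg cg.
by exists h.
Qed.

Section MorphismValues.
Variables (G H : groupType) (h : G -> H).
Hypothesis hM : forall x y, h (x * y) = h x * h y.

Lemma morph_1 : h 1 = 1.
Proof. by apply: (mulgI (h 1)); rewrite -hM !mulg1. Qed.

Lemma morph_V x : h x^-1 = (h x)^-1.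
Proof. by apply: (mulgI (h x)); rewrite -hM !mulgV morph_1. Qed.

Lemma morph_R x y : h [~ x, y] = [~ h x, h y].
Proof. by rewrite !(commgEl, conjgE) !(hM, morph_V). Qed.
End MorphismValues.

(** The cosets are the fibres of [theta], and the powers [x1 ^+ k] with [k < p] meet each fibre
    once. *)
Lemma has_index_kernel_Fp (K : groupType) p (theta : K -> 'F_p) : prime p ->
  (forall x y, theta (x * y) = (theta x + theta y)%R) ->
  (exists x, theta x = 1%R) ->
  normal_subgroup [set x | theta x = 0%R] /\
    has_index [set x | theta x = 0%R] p.
Proof.
move=> p_pr thM [x1 thx1].
pose th : K -> additive_group 'F_p := theta.
have th1 : theta 1 = 0%R by exact: (@morph_1 _ _ th).
have thV x : theta x^-1 = (- theta x)%R by exact: (@morph_V _ _ th).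
have thX n : theta (x1 ^+ n) = n%:R%R.
  by elim: n => [|n IHn]; rewrite ?expg0 // expgS thM IHn thx1 mulrS.
split.
  split; first split=> [//|x y /= tx ty|x /= tx].
  - by rewrite thM tx ty addr0.
  - by rewrite thV tx oppr0.
  - by move=> x y /= tx; rewrite conjgE !thM thV tx add0r addNr.
have cosetE x : left_coset [set x | theta x = 0%R] x =
  theta @^-1` [set theta x].
  apply/seteqP; split=> [_ [h /= th0 <-]|y /= ty];
    first by rewrite /= thM th0 addr0.
  by exists (x^-1 * y); rewrite /= ?mulVKg // thM thV ty addNr.
have FpE k : (k < p)%N -> (k%:R%R : 'F_p) = k :> nat.
  by move=> kp; rewrite val_Fp_nat // modn_small.
rewrite /has_index.
suff -> : left_cosets [set x | theta x = 0%R] =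
    [set theta @^-1` [set k%:R%R] | k in `I_p].
  apply: inj_card_eq => k l /set_mem kp /set_mem lp e.
  rewrite -(FpE k) // -(FpE l) //; congr nat_of_ord.
  have : (theta @^-1` [set k%:R%R]) (x1 ^+ k) by exact: thX.
  by rewrite e /= thX.
apply/seteqP; split=> [_ [x _ <-]|_ [k _ <-]].
  exists (theta x : nat) => /=;
    first by rewrite -[X in (_ < X)%N](Fp_cast p_pr) ltn_ord.
  by rewrite cosetE natr_Zp.
by exists (x1 ^+ k) => //; rewrite cosetE thX.
Qed.

(** * Subgroups of index p in the kernel *)

Lemma finite_setT_finType (T : finType) : finite_set [set: T].
Proof. exact: finite_finset. Qed.

Section ManySubgroups.
Variables (p r n : nat).
Hypotheses (p_pr : prime p) (qE : r.+2 = (p ^ n)%N).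
Local Notation q := r.+2.
Local Notation W := (wreath 'F_p 'Z_q).
Local Notation A := ('F_p * 'Z_q)%type.
Local Notation dW := (discrete_group (finite_setT_finType W)).
Local Notation dA :=
  (discrete_group (finite_setT_finType A : finite_set [set: additive_group A])).

Lemma exists_index_p_subgroups (G H : profiniteGroupType)
    (f : continuousMorphism G H) (chi : G -> dA) (c : nat) (g1 g2 : G) :
  projective G -> (forall x y, chi (x * y) = chi x * chi y) -> continuous chi ->
  (forall x, f x = 1 -> chi x = 1) ->
  chi g1 = (1%R, 0%R) -> chi g2 = (0%R, 1%R) ->
  f (iter c (fun w => [~ w, g2]) g1) = 1 ->
  exists U : nat -> set (kernel f),
    (forall i, (i + c < q)%N ->
      [/\ open (U i), normal_subgroup (U i) & has_index (U i) p]) /\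
    (forall i j, (i < j)%N -> (j + c < q)%N -> U i <> U j).
Proof.
move=> projG chiM chic fchi chi1 chi2 fc.
have [phi phiE] := continuous_morphism_of_fun chiM chic.
have [alpha alphaE] : exists alpha : continuousMorphism dW dA,
    forall e, alpha e = wreath_proj e.
  apply: continuous_morphism_of_fun; first exact: wreath_projM.
  apply: (@continuous_to_discrete _ _ dW) => x.
  apply: (@filterS _ (nbhs x) (nbhs_filter x));
    last exact: (@discrete_group_nbhs1 _ _ x).
  by move=> y ->.
have [gamma gammaE] : exists gamma : continuousMorphism G dW,
    forall x, alpha (gamma x) = phi x.
  apply: projG; apply/seteqP; split=> // a _.
  by have [e <-] := wreath_proj_surj a; exists e => //; rewrite alphaE.
have gammaP x : wreath_proj (gamma x) = chi x by rewrite -alphaE gammaE phiE.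
have fM x y : f (x * y) = f x * f y by exact: gmulfM.
have gammaM x y : gamma (x * y) = gamma x * gamma y by exact: gmulfM.
pose b := (gamma g1).1.
(* Both facts are read off from [chi g1 = (1, 0)], since [gamma] lifts [chi] through the sum of
   coordinates. *)
have [g1E sumb] : gamma g1 = (b, 0%R) /\ (\sum_k b k = 1)%R.
  have := gammaP g1; rewrite chi1 /b; case: (gamma g1) => v i [/= sv ->].
  by [].
have g2E : gamma g2 = ((gamma g2).1, 1%R).
  by have := gammaP g2; rewrite chi2; case: (gamma g2) => v i [/= _ ->].
pose w j := iter j (fun w => [~ w, g2]) g1.
have wE j : gamma (w j) = (iter j (@fdiff p r) b, 0%R).
  elim: j => [//|j IHj]; rewrite /= (morph_R gammaM) -/(w j) IHj g2E.
  exact: wreath_commg.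
have fw j : (c <= j)%N -> f (w j) = 1.
  move=> /subnK <-; rewrite /w iterD; elim: (j - c)%N => [//|m IHm] /=.
  by rewrite (morph_R fM) IHm commgEl conj1g mulVg.
pose theta i (x : kernel f) : 'F_p := iter i (@fdiff p r) (gamma (val x)).1 0%R.
(* As [chi] is trivial on the kernel, [gamma] sends it into the base group, where the product is
   addition of functions. *)
have theta_mul i (x y : kernel f) : theta i (x * y) = (theta i x + theta i y)%R.
  have x2 : (gamma (val x)).2 = 0%R.
    have /set_mem/fchi : val x \in ker_set f := valP x.
    by rewrite -gammaP => -[].
  rewrite /theta; have -> : (gamma (val (x * y))).1 =
      ((gamma (val x)).1 + (gamma (val y)).1)%R.
    rewrite /= gammaM; apply/ffunP => k; rewrite !ffunE /=.
    by rewrite x2 subr0.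
  by rewrite iter_fdiffD ffunE.
have wK j : (c <= j)%N -> w j \in ker_set f by move=> /fw e; apply/mem_set.
pose kw j (cj : (c <= j)%N) : kernel f := exist (fun x =>
  x \in ker_set f) _ (wK j cj).
have thetaw i j cj : theta i (@kw j cj) = iter (i + j) (@fdiff p r) b 0%R.
  by rewrite /theta /= wE /= iterD.
exists (fun i => [set x | theta i x = 0%R]); split=> [i ic|i j ij jc].
  (* At the index [q.-1 - i] the total number of differences is [q.-1], so [theta i] takes there the
     coordinate sum of [b], which is 1. *)
  have cj : (c <= q.-1 - i)%N by lia.
  have [] := @has_index_kernel_Fp _ p (theta i) p_pr (theta_mul i).
    exists (kw _ cj); rewrite thetaw subnKC ?(iter_fdiff_top p_pr qE) //.
    by lia.
  move=> nU iU; split=> //.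
  (* Openness holds because [theta i] factors through the continuous [gamma] into a discrete
     group. *)
  rewrite openE => x /= tx; rewrite /interior.
  have : nbhs (gamma (val x)) [set gamma (val x)] by exact:
    discrete_group_nbhs1.
  move=> /(@cts_fun _ _ gamma) /(@set_val_continuous _ (ker_set f) x).
  apply: (@filterS _ (nbhs x) (nbhs_filter x)) => y /= e.
  by rewrite /theta /= e.
have cj : (c <= q.-1 - i)%N by lia.
have iq : (i <= q.-1)%N by lia.
(* The element of index [q.-1 - i] separates the two sets: [theta i] is 1 on it, while [theta j]
   applies at least [q] differences and vanishes. *)
move=> /seteqP[_ /(_ (kw _ cj))] /=; rewrite !thetaw subnKC //.
rewrite (iter_fdiff_top p_pr qE) sumb (iter_fdiff_big p_pr qE).
  by rewrite ffunE => /(_ erefl) /eqP; rewrite oner_eq0.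
by lia.
Qed.

End ManySubgroups.

(** * Nilpotency and finite quotients of the profinite completion *)

Section Completion.
Variable N : groupType.
Implicit Types (x y : N) (c d : profinite_completion N).

Lemma completion_unit_subproof x :
  inverse_limit (fun M : @finite_index_normal N => left_coset (val M) x).
Proof.
split=> [M|M M' sM]; first by exists x.
by move=> _ [h Mh <-]; exists h => //; exact: sM.
Qed.

Definition completion_unit x : profinite_completion N :=
  exist (fun g => g \in @inverse_limit N) _ (mem_set (completion_unit_subproof
    x)).

(** Each coordinate is a coset of an element of [N], so the iterated commutator can be computed
    there on representatives. *)
Lemma nilpotent_completion_iter_commg n c d :
  lower_central_series n = [set (1 : N)] ->
  iter n (fun w => [~ w, d]) c = 1.
Proof.
move=> ln; apply: pc_ext => M; have nM := fin_normal M.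
have [x cx] := pc_coset c M; have [y dy] := pc_coset d M.
have [z lz ->] : exists2 z, lower_central_series n z &
    val (iter n (fun w => [~ w, d]) c) M = left_coset (val M) z.
  elim: n {ln} => [|n [z lz IHn]]; first by exists x.
  exists [~ z, y]; first exact: lcs_comm.
  rewrite /= IHn dy !left_cosetV // !left_cosetM //.
by move: lz; rewrite ln => ->; rewrite left_coset1.
Qed.

(** The kernel [M0] of [chi] has finite index. The extension reads only the coordinate at [M0],
    whence its continuity. *)
Lemma completion_extension (Q : groupType) (finQ : finite_set [set: Q])
    (chi : N -> Q) : (forall x y, chi (x * y) = chi x * chi y) ->
  exists chih : profinite_completion N -> discrete_group finQ,
    [/\ forall c d, chih (c * d) = chih c * chih d, continuous chih &
        forall x, chih (completion_unit x) = chi x].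
Proof.
move=> chiM; pose M0 := [set x | chi x = 1].
have chi1 := morph_1 chiM; have chiV := morph_V chiM.
have nM0 : normal_subgroup M0.
  split; first split=> [//|x y /= ex ey|x /= ex].
  - by rewrite /M0 /= chiM ex ey mulg1.
  - by rewrite /M0 /= chiV ex invg1.
  - by move=> x y /= ex; rewrite /M0 /= conjgE !chiM chiV ex mul1g mulVg.
have cosetE x : left_coset M0 x = chi @^-1` [set chi x].
  apply/seteqP; split=> [_ [h /= h1 <-]|y /= ey];
    first by rewrite /= chiM h1 mulg1.
  by exists (x^-1 * y); rewrite /M0 /= ?mulVKg // chiM chiV ey mulVg.
have fM0 : finite_set (left_cosets M0).
  apply: (@sub_finite_set _ _ [set chi @^-1` [set a] | a in [set: Q]]);
    last exact: finite_image.
  by move=> _ [x _ <-]; exists (chi x) => //; rewrite cosetE.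
pose M : @finite_index_normal N :=
  exist (fun g => g \in @finite_index_normal N) M0 (mem_set (conj nM0 fM0)).
(* The default 1 is never reached, since cosets are nonempty. *)
pose rep c := xget 1 (val c M).
have repP c x : val c M = left_coset M0 x -> chi (rep c) = chi x.
  rewrite /rep cosetE => ->.
  by apply: (@xgetPex _ 1 (chi @^-1` [set chi x])); exists x.
exists (fun c => chi (rep c)); split=> [c d||x].
- have [x cx] := pc_coset c M; have [y dy] := pc_coset d M.
  rewrite (repP c x) // (repP d y) // (repP _ (x * y)) ?chiM //.
  by rewrite /= cx dy left_cosetM.
- apply: (@continuous_to_discrete Q) => c.
  by apply: filterS (pc_coord_nbhs c M) => d /= e; rewrite /rep /= e.
- exact: repP.
Qed.

End Completion.

Theorem theorem4p2 (N : groupType) :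
  infinite_set [set: N] ->
  finitely_generated N ->
  nilpotent_group N ->
  ~ cyclic_group N ->
  forall (G : profiniteGroupType)
    (f : continuousMorphism G (profinite_completion N)),
  universal_frattini_cover f ->
  ~ small (kernel f).
Proof.
move=> infN fgN nilN ncN G f [[epif _] projG] smallK.
have [p p_pr [phi [psi [phiM psiM [t phit psit] [s phis psis]]]]] :=
  exists_int_and_mod_prime_homs infN fgN nilN ncN.
have [c lc] := nilN.
have /finite_seqP[X XE] := smallK p (prime_gt0 p_pr).
(* Since [p ^ m > m], at least [size X + 1] indices [i] satisfy [i + c < p ^ m]. *)
pose m := (size X + c).+2.
have [r qE] : exists r, r.+2 = (p ^ m)%N.
  by exists (p ^ m).-2; have := ltn_expl m (prime_gt1 p_pr);
    case: (p ^ m)%N => [|[]].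
pose chi x : additive_group ('F_p * 'Z_r.+2)%type := (psi x, (phi x)%:~R)%R.
have chiM x y : chi (x * y) = chi x * chi y.
  by rewrite /chi phiM psiM intrD.
have [chih [chihM chihc chihE]] := completion_extension
  (finite_setT_finType ('F_p * 'Z_r.+2)%type) chiM.
have fsurj d : exists g, f g = d.
  by have : (f @` [set: G]) d; [rewrite epif|case=> g _ <-; exists g].
have [g1 fg1] := fsurj (completion_unit s);
  have [g2 fg2] := fsurj (completion_unit t).
have fM x y : f (x * y) = f x * f y by exact: gmulfM.
have [||||||U [UP Uinj]] :=
  @exists_index_p_subgroups p r m p_pr qE G _ f (chih \o f) c g1 g2 projG.
- by move=> x y /=; rewrite fM chihM.
- by move=> x; apply: continuous_comp; [exact: cts_fun|exact: chihc].
- by move=> x /= ->; exact: (morph_1 chihM).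
- by rewrite /= fg1 chihE /chi phis psis.
- by rewrite /= fg2 chihE /chi phit psit.
- have -> i : f (iter i (fun w => [~ w, g2]) g1) = iter i (fun w =>
  [~ w, f g2]) (f g1).
    by elim: i => //= i <-; rewrite (morph_R fM).
  exact: nilpotent_completion_iter_commg.
pose k := (size X).+1.
have kq : (k + c < r.+2)%N.
  by rewrite qE; have := ltn_expl m (prime_gt1 p_pr); rewrite /m /k; lia.
(* Pigeonhole: [size X + 1] distinct subgroups would all belong to the list [X]. *)
have := @uniq_leq_size _ [seq U i | i <- iota 0 k] X.
rewrite size_map size_iota ltnn => H; apply: notF; apply: H.
  rewrite map_inj_in_uniq ?iota_uniq // => i j;
    rewrite !mem_iota !add0n /= => ik jk e.
  have lt_c l : (l < k)%N -> (l + c < r.+2)%N.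
    by lia.
  by case: (ltngtP i j) => // ij;
    [have []:= Uinj _ _ ij (lt_c _ jk)|have []:= Uinj _ _ ij (lt_c _ ik)].
move=> _ /mapP[i + ->]; rewrite mem_iota add0n /= => ik.
have : [set` X] (U i); last by [].
rewrite -XE /=; apply: UP; apply: leq_ltn_trans kq; rewrite leq_add2r ltnW //.
Qed.
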